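(* Suppose Assumption A holds with constant $d$, and that there is a constant $L^\circ\in[1,\infty)$ (depending on $\theta^\circ,\lambda,\eta$) such that $\sup_{0<\epsilon<1}\epsilon\,m^\circ_\epsilon\Lambda_{(m^\circ_\epsilon)}/\Phi^\circ_\epsilon\le L^\circ$. If moreover $m^\circ_\epsilon\to\infty$ as $\epsilon\to0$, then with $K^\circ:=10((1+d^{-1})\vee d^{-2}\|\theta^\circ-\eta\|^2)L^\circ$, $$\lim_{\epsilon\to0}\mathbb E_{\theta^\circ}P_{\vartheta^{m^\circ_\epsilon}|Y}\Big((K^\circ)^{-1}\Phi^\circ_\epsilon\le\|\vartheta^{m^\circ_\epsilon}-\theta^\circ\|^2\le K^\circ\Phi^\circ_\epsilon\Big)=1.$$
   Context: Let $\ell^2$ be the space of square-summable real sequences with norm $\|\cdot\|$. Fix a bounded real sequence $\lambda=(\lambda_j)_{j\ge1}$ with $\lambda_j\ne0$ for all $j$, a noise level $\epsilon\in(0,1)$ and a true parameter $\theta^\circ\in\ell^2$. The data $Y=(Y_j)_{j\ge1}$ satisfy $Y_j=\lambda_j\theta^\circ_j+\sqrt\epsilon\,\xi_j$ with $\xi_j$ i.i.d. $N(0,1)$; $\mathbb E_{\theta^\circ}$, $P_{\theta^\circ}$ denote expectation and probability under this law. Fix prior means $\eta=(\eta_j)_{j\ge1}$ with $\theta^\circ-\eta\in\ell^2$ and prior variances $\tau_j\in(0,\infty)$ (possibly depending on $\epsilon$). For $m\in\mathbb N$ the sieve prior $P_{\vartheta^m}$ is the law of $\vartheta^m=(\vartheta^m_j)_{j\ge1}$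 with independent coordinates, $\vartheta^m_j\sim N(\eta_j,\tau_j)$ for $j\le m$ and $\vartheta^m_j=\eta_j$ a.s. for $j>m$, in the model $Y_j=\lambda_j\vartheta^m_j+\sqrt\epsilon\xi_j$ with $\vartheta^m$ independent of $(\xi_j)$. Put $\sigma_j:=(\lambda_j^2\epsilon^{-1}+\tau_j^{-1})^{-1}$ and $\theta^Y_j:=\sigma_j(\tau_j^{-1}\eta_j+\lambda_j\epsilon^{-1}Y_j)$. The posterior $P_{\vartheta^m|Y}$ makes the coordinates independent with $\vartheta^m_j\sim N(\theta^Y_j,\sigma_j)$ for $j\le m$ and $\vartheta^m_j=\eta_j$ for $j>m$; the Bayes estimator is $\hat\theta^m:=\mathbb E[\vartheta^m|Y]$. Define $b_m:=\sum_{j>m}(\theta^\circ_j-\eta_j)^2$. Let $\Lambda_j:=\lambda_j^{-2}$, $\Lambda_{(m)}:=\max_{1\le j\le m}\Lambda_j$, $\bar\Lambda_m:=m^{-1}\sum_{j=1}^m\Lambda_j$ and $\Phi^m_\epsilon:=b_m\vee\epsilon m\bar\Lambda_m$. Let $G_\epsilon:=\max\{1\le m\le\lfloor\epsilon^{-1}\rfloor:\epsilon\Lambda_{(m)}\le\Lambda_1\}$. Assumption A: there is a constant $d>0$ such that $\tau_j\ge d\,(\epsilon^{1/2}\Lambda_j^{1/2}\vee\epsilon\Lambda_j)$ for all $1\le j\le G_\epsilon$ and all $\epsilon\in(0,1)$. Oracle quantities: $m^\circ_\epsilon:=\min\{m\ge1:\Phi^m_\epsilon\le\Phi^k_\epsilon\text{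 for all }k\ge1\}$ and $\Phi^\circ_\epsilon:=\Phi^{m^\circ_\epsilon}_\epsilon=\min_{m\ge1}\Phi^m_\epsilon$. *)

(* Defs.v *)
From HB Require Import structures.
From mathcomp Require Import all_boot all_order all_algebra.
From mathcomp Require Import all_classical all_reals all_analysis.
Set Implicit Arguments. Unset Strict Implicit. Unset Printing Implicit Defensive.
Import Order.TTheory GRing.Theory Num.Theory.
Import numFieldNormedType.Exports.
Local Open Scope classical_set_scope.
Local Open Scope ring_scope.

(* Convention: sequences are indexed from 0; the paper's coordinate j >= 1
   is stored at index j-1.  So "j <= m" in the paper is "j < m" here. *)

Section Defs.
Variable R : realType.

(* squared l^2 norm of a sequence (meaningful for square-summable x) *)
Definition sqnorm (x : nat -> R) : R := limn (series (fun j => x j ^+ 2)).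

Definition bias (theta eta : nat -> R) (m : nat) : R :=
  limn (fun n => \sum_(m <= j < n) (theta j - eta j) ^+ 2).

Definition Lam (lam : nat -> R) (j : nat) : R := (lam j ^+ 2)^-1.
Definition LamMax (lam : nat -> R) (m : nat) : R :=
  \big[Num.max/0]_(j < m) Lam lam j.
Definition LamBar (lam : nat -> R) (m : nat) : R :=
  (\sum_(j < m) Lam lam j) / m%:R.

Definition Phi (theta eta lam : nat -> R) (eps : R) (m : nat) : R :=
  Num.max (bias theta eta m) (eps * m%:R * LamBar lam m).

Definition is_oracle_dim (theta eta lam : nat -> R) (eps : R) (m : nat) : Prop :=
  [/\ (1 <= m)%N,
      (forall k, (1 <= k)%N -> Phi theta eta lam eps m <= Phi theta eta lam eps k) &
      (forall m', (1 <= m')%N -> (m' < m)%N ->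
         ~ (forall k, (1 <= k)%N -> Phi theta eta lam eps m' <= Phi theta eta lam eps k))].

Definition Geps (lam : nat -> R) (eps : R) : nat :=
  \max_(m < (Num.truncn (eps^-1)).+1 | (1 <= (m : nat))%N && (eps * LamMax lam m <= Lam lam 0)) (m : nat).

(* Assumption A with constant d; tau eps j is the prior variance (may depend on eps) *)
Definition AssumptionA (lam : nat -> R) (tau : R -> nat -> R) (d : R) : Prop :=
  0 < d /\
  forall eps, 0 < eps < 1 -> forall j, (j < Geps lam eps)%N ->
    d * Num.max (Num.sqrt (eps * Lam lam j)) (eps * Lam lam j) <= tau eps j.

(* iterated integral against a product of normal laws N(mean, sd^2) *)
Fixpoint gint (l : seq (R * R)) (f : seq R -> \bar R) : \bar R :=
  match l with
  | [::] => f [::]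
  | p :: l' => (\int[normal_prob p.1 p.2]_x gint l' (fun xs => f (x :: xs)))%E
  end.

(* completion of the first coordinates by the prior means *)
Definition extend (eta : nat -> R) (xs : seq R) : nat -> R :=
  fun j => if (j < size xs)%N then nth 0 xs j else eta j.

Definition post_var (lam : nat -> R) (tau : nat -> R) (eps : R) (j : nat) : R :=
  (lam j ^+ 2 / eps + (tau j)^-1)^-1.

Definition post_mean (lam tau eta : nat -> R) (eps : R) (Y : nat -> R) (j : nat) : R :=
  post_var lam tau eps j * ((tau j)^-1 * eta j + lam j / eps * Y j).

(* P_{vartheta^m | Y}(A): the posterior law of vartheta^m: coordinates j < m
   independent N(theta^Y_j, sigma_j), coordinates j >= m equal to eta_j a.s. *)
Definition post_prob (lam tau eta : nat -> R) (eps : R) (m : nat) (Y : nat -> R)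
    (A : set (nat -> R)) : \bar R :=
  gint [seq (post_mean lam tau eta eps Y j, Num.sqrt (post_var lam tau eps j)) | j <- iota 0 m]
       (fun xs => (\1_A (extend eta xs))%:E).

(* data Y_j = lam_j theta_j + sqrt eps xi_j built from the noise xi_0..xi_{m-1} *)
Definition data_of (lam theta : nat -> R) (eps : R) (xi : seq R) : nat -> R :=
  fun j => lam j * theta j + Num.sqrt eps * nth 0 xi j.

(* E_theta[F(Y)] for a functional F of Y depending only on Y_0..Y_{m-1}:
   integrate over xi_0, ..., xi_{m-1} iid N(0,1). *)
Definition Eth (lam theta : nat -> R) (eps : R) (m : nat) (F : (nat -> R) -> \bar R) : \bar R :=
  gint (nseq m (0, 1)) (fun xi => F (data_of lam theta eps xi)).

End Defs.

(* Main.v *)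
Require Import Defs.
From HB Require Import structures.
From mathcomp Require Import all_boot all_order all_algebra.
From mathcomp Require Import all_classical all_reals all_analysis.
From mathcomp Require Import measurable_realfun ring lra.
Import Order.TTheory GRing.Theory Num.Theory.
Import numFieldNormedType.Exports.
Local Open Scope classical_set_scope.
Local Open Scope ring_scope.

(** Integrating the posterior over the data makes the errors [v_j - theta_j],
    [j < m], independent and normal with mean [a_j] and variance [s_j], where
    [a_j ^+ 2 <= d^-2 * eps * Lam_j * (theta_j - eta_j) ^+ 2] and
    [eps * Lam_j / (1 + d^-1) <= s_j <= 2 * eps * Lam_j].  The squared loss [S]
    thus has expectation between [Phi / (1 + d^-1)] and
    [4 * max (1 + d^-1) (d^-2 * |theta - eta|^2) * Lo * Phi], and its variance
    [sum_j (4 * a_j ^+ 2 * s_j + 2 * s_j ^+ 2)] is [O(Phi ^+ 2 / m)] because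
    [eps * Lam_j <= Lo * Phi / m].  Chebyshev's inequality gives a bound
    [1 - C / m], and [m] tends to infinity.  Chebyshev is applied pointwise, as
    [1 - k * (S - E S) ^+ 2 <= \1_A], so that only polynomials have to be
    integrated exactly; the Lebesgue integral being a supremum over simple
    functions, it is monotone without any measurability of [\1_A]. *)

(** * Integration against normal laws *)

Lemma le_integral_no_measurability d (T : measurableType d) (R : realType)
    (mu : {measure set T -> \bar R}) (f g : T -> \bar R) :
  (forall x, f x <= g x)%E -> (\int[mu]_x f x <= \int[mu]_x g x)%E.
Proof.
move=> fg.
have ge0 (h1 h2 : T -> \bar R) : (forall x, 0 <= h1 x)%E ->
    (forall x, h1 x <= h2 x)%E -> (\int[mu]_x h1 x <= \int[mu]_x h2 x)%E.
  move=> h10 h12.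
  rewrite !ge0_integralTE//; last by move=> x; exact: le_trans (h12 x).
  apply: ereal_sup_le => _ [h /= hh1 <-]; exists h => // x /=.
  exact: le_trans (hh1 x) (h12 x).
rewrite integralE [leRHS]integralE leeB//.
- by apply: ge0 => // x; rewrite !funeposE le_max2.
- by apply: ge0 => // x; rewrite !funenegE le_max2// leeN2.
Qed.

(** The Radon-Nikodym derivative of [normal_prob m s] and [normal_pdf m s] have the same integral
    over every measurable set, so they agree almost everywhere and can be exchanged in the change of
    variables. *)
Lemma integral_normal_prob_ge0 (R : realType) (m s : R) (f : R -> \bar R) :
  measurable_fun setT f -> (forall x, 0 <= f x)%E ->
  (\int[normal_prob m s]_x f x =
   \int[lebesgue_measure]_x (f x * (normal_pdf m s x)%:E))%E.
Proof.
move=> mf f0.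
have dom := normal_prob_dominates m s.
have ig := Radon_Nikodym_SigmaFinite.f_integrable dom.
rewrite -(Radon_Nikodym_SigmaFinite.change_of_variables dom)//.
apply: ae_eq_integral => //.
- apply: emeasurable_funM => //; exact: measurable_int ig.
- by apply: emeasurable_funM => //; apply/measurable_EFinP; exact: measurable_normal_pdf.
- apply: ae_eqe_mul2l; apply: integral_ae_eq => //.
  + by apply/measurable_EFinP; exact: measurable_normal_pdf.
  + move=> E _ mE; rewrite -Radon_Nikodym_SigmaFinite.f_integral//.
Qed.

(** A nonnegative density commutes with taking positive and negative parts, so the nonnegative case
    applies to each part and integrability of [f] need not be known beforehand. *)
Lemma integral_normal_prob (R : realType) (m s : R) (f : R -> R) :
  measurable_fun setT f ->
  (\int[normal_prob m s]_x (f x)%:E =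
   \int[lebesgue_measure]_x (f x * normal_pdf m s x)%:E)%E.
Proof.
move=> mf; have mEf : measurable_fun setT (EFin \o f) by exact/measurable_EFinP.
rewrite integralE [RHS]integralE; congr (_ - _)%E.
- rewrite integral_normal_prob_ge0//; last exact: measurable_funepos.
  apply: eq_integral => x _.
  by rewrite !funeposE EFinM maxe_pMl ?lee_fin ?normal_pdf_ge0// mul0e.
- rewrite integral_normal_prob_ge0//; last exact: measurable_funeneg.
  apply: eq_integral => x _.
  by rewrite !funenegE EFinM maxe_pMl ?lee_fin ?normal_pdf_ge0// mul0e mulNe.
Qed.

Lemma cvg_integral_sym_itv (R : realType) (m : R) (f : R -> R) :
  (@lebesgue_measure R).-integrable setT (EFin \o f) ->
  (\int[lebesgue_measure]_(x in `[(m - n%:R)%R, (m + n%:R)%R]) (f x)%:E)%E @[n --> \oo]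
   --> (\int[lebesgue_measure]_x (f x)%:E)%E.
Proof.
move=> intf.
have mf := measurable_int _ intf.
pose f_ n := (EFin \o f) \_ `[m - n%:R, m + n%:R].
under eq_fun do rewrite integral_mkcond.
have := @dominated_convergence _ _ _ (@lebesgue_measure R) setT measurableT
  f_ (EFin \o f) (abse \o (EFin \o f)).
case => //.
- move=> n; apply: (measurable_restrictT _ _).1 => //.
  exact: measurable_funTS.
- apply: aeW => x _.
  apply: cvg_near_cst; near=> n.
  rewrite /f_ patchE mem_set//= in_itv/=.
  have : `|x - m| <= n%:R by near: n; exact: nbhs_infty_ger.
  by rewrite ler_norml => /andP[? ?]; apply/andP; split; lra.
- exact: integrable_abse.
- apply: aeW => x n _; rewrite /f_ patchE; case: ifP => //=.
  by rewrite normr0 lee_fin.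
Unshelve. all: end_near.
Qed.

(** By the fundamental theorem of calculus on growing intervals around [m], only boundary terms
    remain, and these vanish. This serves as integration by parts for the moments. *)
Lemma integral_derivative_eq0 (R : realType) (m : R) (f F : R -> R) :
  (@lebesgue_measure R).-integrable setT (EFin \o f) ->
  continuous f -> (forall x : R, is_derive x 1 F (f x)) ->
  F (m + n%:R) - F (m - n%:R) @[n --> \oo] --> (0 : R) ->
  (\int[lebesgue_measure]_x (f x)%:E = 0)%E.
Proof.
move=> intf cf dF F0.
have cF x : {for x, continuous F}.
  by apply: differentiable_continuous; apply/derivable1_diffP; exact: ex_derive.
have h := @cvg_integral_sym_itv R m f intf.
rewrite -(cvg_lim _ h)//; apply: cvg_lim => //.
apply: (@cvg_trans _ ((F (m + n%:R) - F (m - n%:R))%:E @[n --> \oo])); last first.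
  apply: cvg_EFin; [exact: nearW|exact: F0].
apply: near_eq_cvg; near=> n.
have n0 : (0 < n)%N by near: n; exact: nbhs_infty_gt.
have nR : 0 < n%:R :> R by rewrite ltr0n.
rewrite (@continuous_FTC2 _ f F) ?EFinB//.
- lra.
- exact: continuous_subspaceT.
- split.
  + by move=> x _; exact: ex_derive.
  + by apply: cvg_at_right_filter; exact: cF.
  + by apply: cvg_at_left_filter; exact: cF.
- by move=> x _; rewrite derive1E; exact: derive_val.
Unshelve. all: end_near.
Qed.

(** * Central moments of the normal law up to order four *)

Section normal_moments.
Variables (R : realType) (m s : R).
Hypothesis s0 : s != 0.

Let le_pow_quartic (y : R) k : (k <= 4)%N -> `|y ^+ k| <= 1 + y ^+ 4.
Proof.
move=> k4; have y4 : 0 <= y ^+ 4 by rewrite exprn_even_ge0.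
rewrite normrX; have [y1|y1] := leP `|y| 1.
  by apply: (@le_trans _ _ 1); [exact: exprn_ile1|rewrite lerDl].
rewrite (@le_trans _ _ (`|y| ^+ 4))//.
  by rewrite ler_weXn2l// ltW.
by rewrite -normrX ger0_norm// lerDr.
Qed.

(** Squaring [1 + t / 2 <= expR (t / 2)] gives [t ^+ 2 / 4 <= expR t]. *)
Let sqr_expRN_le (t : R) : 0 <= t -> t ^+ 2 * expR (- t) <= 4.
Proof.
move=> t0; rewrite expRN ler_pdivrMr ?expR_gt0//.
have -> : t = t / 2 + t / 2 by lra.
rewrite expRD.
have := expR_ge1Dx (t / 2); nra.
Qed.

Let s' := Num.sqrt 2 * s.
(** The ratio of peaks exchanges the two normalizations. With [t = (x - m) ^+ 2 / (4 * s ^+ 2)] the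
    quartic is [16 * s ^+ 4 * t ^+ 2], and [t ^+ 2 * expR (- t) <= 4] yields the factor 64. *)
Let C := normal_peak s * (1 + 64 * s ^+ 4) / normal_peak s'.

Let s2 : 0 < s ^+ 2. Proof. by rewrite exprn_even_gt0. Qed.

Let s'0 : s' != 0. Proof. by rewrite mulf_neq0// gt_eqF// sqrtr_gt0. Qed.

Let C_ge0 : 0 <= C.
Proof.
rewrite divr_ge0 ?normal_peak_ge0// mulr_ge0 ?normal_peak_ge0//.
by rewrite addr_ge0// mulr_ge0// exprn_even_ge0.
Qed.

(* The quartic factor is absorbed by half of the exponent, which leaves a normal
   density with variance [2 * s ^+ 2]. *)
Let pow_normal_pdf_le k x : (k <= 4)%N ->
  `|(x - m) ^+ k * normal_pdf m s x| <= C * normal_pdf m s' x.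
Proof.
move=> k4.
have peak0 : 0 < normal_peak s by exact: normal_peak_gt0.
have peak'0 : 0 < normal_peak s' by exact: normal_peak_gt0.
have s'2 : s' ^+ 2 = 2 * s ^+ 2 by rewrite exprMn sqr_sqrtr.
rewrite normrM (ger0_norm (normal_pdf_ge0 _ _ _)) !normal_pdfE//=.
rewrite [leRHS]mulrA /C divfK ?gt_eqF//.
rewrite mulrCA -mulrA ler_pM2l//.
pose t := (x - m) ^+ 2 / (4 * s ^+ 2).
have t0 : 0 <= t by rewrite divr_ge0 ?sqr_ge0// mulr_ge0// ltW.
have -> : normal_fun m s x = expR (- t) * expR (- t).
  by rewrite -expRD /normal_fun /t; congr expR; field.
have -> : normal_fun m s' x = expR (- t).
  by rewrite /normal_fun /t s'2; congr expR; field.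
rewrite mulrA ler_pM2r ?expR_gt0//.
have y4 : (x - m) ^+ 4 = 16 * s ^+ 4 * t ^+ 2 by rewrite /t; field.
have e1 : expR (- t) <= 1 by rewrite -expR0 ler_expR oppr_le0.
have e0 := expR_gt0 (- t).
have := sqr_expRN_le t t0; have := le_pow_quartic (x - m) k k4; rewrite y4.
have : 0 <= s ^+ 4 by rewrite exprn_even_ge0.
move: (s ^+ 4) (`|(x - m) ^+ k|) => S P S0 hP hT.
apply: (@le_trans _ _ ((1 + 16 * S * t ^+ 2) * expR (- t))).
  by rewrite ler_pM2r.
rewrite mulrDl mul1r -mulrA lerD//.
have -> : 64 * S = 16 * S * 4 by ring.
by apply: ler_pM => //; nra.
Qed.

Lemma integrable_pow_normal_pdf k : (k <= 4)%N ->
  (@lebesgue_measure R).-integrable setT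
    (fun x => ((x - m) ^+ k * normal_pdf m s x)%:E).
Proof.
move=> k4.
apply: (@le_integrable _ _ _ (@lebesgue_measure R) setT measurableT _
  (fun x => (C%:E * (normal_pdf m s' x)%:E)%E)).
- apply/measurable_EFinP; apply: measurable_funM; last exact: measurable_normal_pdf.
  by apply: measurable_funX; exact: measurable_funB.
- move=> x _; rewrite -EFinM lee_fin (le_trans (pow_normal_pdf_le k x k4))//.
  exact: ler_norm.
- by apply: integrableZl => //; exact: integrable_normal_pdf.
Qed.

(** The uniform bound in degree [k.+1], divided by [|u n - m| = n], gives decay of order [1 / n];
    hence the restriction to [k <= 3]. *)
Let cvg_pow_normal_pdf k (u : nat -> R) : (k <= 3)%N ->
  (forall n, `|u n - m| = n%:R) ->
  (u n - m) ^+ k * normal_pdf m s (u n) @[n --> \oo] --> (0 : R).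
Proof.
move=> k3 um; apply/norm_cvg0P.
pose B := C * normal_peak s'.
apply: (@squeeze_cvgr _ _ _ _ (fun=> 0) (fun n : nat => B * n%:R^-1)).
- near=> n; have n0 : (0 < n)%N by near: n; exact: nbhs_infty_gt.
  rewrite normr_ge0/= ler_pdivlMr ?ltr0n// -(um n) -normrM mulrAC -exprSr.
  rewrite (le_trans (pow_normal_pdf_le _ (u n) _))// ler_wpM2l//.
  exact: normal_pdf_ub.
- exact: cvg_cst.
- rewrite -[X in _ --> X](mulr0 B); apply: cvgMl_tmp.
  apply/gtr0_cvgV0; last exact: cvgr_idn.
  by near=> n; rewrite ltr0n; near: n; exact: nbhs_infty_gt.
Unshelve. all: end_near.
Qed.

Let is_derive_normal_pdf (x : R) :
  is_derive x 1 (normal_pdf m s) (- (x - m) / s ^+ 2 * normal_pdf m s x).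
Proof.
pose c := - (s ^+ 2 *+ 2)^-1.
have -> : normal_pdf m s = normal_peak s \*: (expR \o (c \*: ((id - cst m) ^+ 2))).
  rewrite normal_pdfE//; apply/funext => y /=.
  by rewrite /normal_fun; congr (_ * expR _); rewrite /c -[RHS]/(_ * _ ^+ 2) mulrC mulrN mulNr.
apply: is_derive_eq.
rewrite /= /GRing.scale/= /c -[(id - cst m) x]/(x - m).
move: (expR _) => E; by field.
Qed.

#[local] Existing Instance is_derive_normal_pdf.

(** For [k = 0] the truncated predecessor [k.-1] is harmless, since its factor [k%:R] vanishes. *)
Let is_derive_pow_normal_pdf k (x : R) :
  is_derive x 1 (fun x => (x - m) ^+ k * normal_pdf m s x)
    (k%:R * ((x - m) ^+ k.-1 * normal_pdf m s x)
     - (s ^+ 2)^-1 * ((x - m) ^+ k.+1 * normal_pdf m s x)).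
Proof.
have powE : (fun x => (x - m) ^+ k) = (id - cst m) ^+ k.
  by apply/funext => y; rewrite fctE.
have -> : (fun x => (x - m) ^+ k * normal_pdf m s x) = (id - cst m) ^+ k * normal_pdf m s.
  by rewrite -powE.
apply: is_derive_eq.
rewrite -powE /= /GRing.scale/= -[(id - cst m) x]/(x - m) (exprSr (x - m) k).
by field.
Qed.

#[local] Existing Instance is_derive_pow_normal_pdf.

Let continuous_pow_normal_pdf k : continuous (fun x => (x - m) ^+ k * normal_pdf m s x).
Proof.
move=> x; apply: differentiable_continuous; apply/derivable1_diffP.
exact: ex_derive.
Qed.

Let moment k := (\int[lebesgue_measure]_x ((x - m) ^+ k * normal_pdf m s x))%R.

Let momentE k : (k <= 4)%N ->
  (\int[lebesgue_measure]_x ((x - m) ^+ k * normal_pdf m s x)%:E)%E = (moment k)%:E.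
Proof.
move=> k4; rewrite /moment /Rintegral fineK//.
by apply: integrable_fin_num => //; exact: integrable_pow_normal_pdf.
Qed.

(** The derivative of [(x - m) ^+ k] times the density has integral zero. The case [k = 0] says that
    the first central moment vanishes. *)
Let moment_rec k : (k <= 3)%N ->
  moment k.+1 = s ^+ 2 * k%:R * moment k.-1.
Proof.
move=> k3.
have k14 : (k.-1 <= 4)%N by rewrite (leq_trans (leq_pred _))// ltnW.
pose f x := (k%:R * ((x - m) ^+ k.-1 * normal_pdf m s x)
     - (s ^+ 2)^-1 * ((x - m) ^+ k.+1 * normal_pdf m s x)).
have i1 := integrable_pow_normal_pdf _ k14.
have i2 := integrable_pow_normal_pdf k.+1 k3.
have j1 : (@lebesgue_measure R).-integrable setT
    (fun x => (k%:R%:E * ((x - m) ^+ k.-1 * normal_pdf m s x)%:E)%E).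
  exact: integrableZl.
have j2 : (@lebesgue_measure R).-integrable setT
    (fun x => ((s ^+ 2)^-1%:E * ((x - m) ^+ k.+1 * normal_pdf m s x)%:E)%E).
  exact: integrableZl.
have : (\int[lebesgue_measure]_x (f x)%:E = 0)%E.
  apply: (@integral_derivative_eq0 _ m f (fun x => (x - m) ^+ k * normal_pdf m s x)).
  - exact: (integrableB measurableT j1 j2).
  - move=> x; apply: cvgB; apply: cvgMl_tmp; exact: continuous_pow_normal_pdf.
  - rewrite -[X in _ --> X](subr0 0); apply: cvgB; apply: cvg_pow_normal_pdf => // n.
      by rewrite addrAC subrr add0r normr_nat.
    by rewrite addrAC subrr add0r normrN normr_nat.
have -> : (\int[lebesgue_measure]_x (f x)%:E)%E = _ :=
  integralB measurableT j1 j2.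
rewrite integralZl// integralZl// !momentE// -!EFinM -EFinB => -[] h.
have : s ^+ 2 * (k%:R * moment k.-1 - (s ^+ 2)^-1 * moment k.+1) = 0 by rewrite h mulr0.
rewrite mulrBr [X in _ - X]mulrA divff ?gt_eqF// mul1r; rewrite mulrA; lra.
Qed.

Let moment0 : moment 0 = 1.
Proof.
rewrite /moment /Rintegral.
under eq_integral do rewrite expr0 mul1r.
by rewrite integral_normal_pdf.
Qed.

Lemma integral_normal_prob_quartic (c0 c1 c2 c3 c4 : R) :
  (\int[normal_prob m s]_x (c0 + c1 * (x - m) + c2 * (x - m) ^+ 2
     + c3 * (x - m) ^+ 3 + c4 * (x - m) ^+ 4)%:E
   = (c0 + c2 * s ^+ 2 + 3 * c4 * s ^+ 4)%:E)%E.
Proof.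
have M1 : moment 1 = 0 by rewrite (moment_rec 0)// mulr0 mul0r.
have M2 : moment 2 = s ^+ 2 by rewrite (moment_rec 1)//= moment0 !mulr1.
have M3 : moment 3 = 0 by rewrite (moment_rec 2)//= M1 mulr0.
have M4 : moment 4 = 3 * s ^+ 4 by rewrite (moment_rec 3)//= M2; ring.
rewrite integral_normal_prob; last first.
  by repeat apply: measurable_funD => //; apply: measurable_funM => //;
     try apply: measurable_funX; exact: measurable_funB.
pose c (i : nat) := nth 0 [:: c0; c1; c2; c3; c4] i.
have i_ (i : 'I_5) : (@lebesgue_measure R).-integrable setT
    (fun x => ((c i)%:E * ((x - m) ^+ i * normal_pdf m s x)%:E)%E).
  by apply: integrableZl => //; apply: integrable_pow_normal_pdf; rewrite -ltnS.
transitivity (\int[lebesgue_measure]_x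
    (\sum_(i < 5) (c i)%:E * ((x - m) ^+ i * normal_pdf m s x)%:E))%E.
  apply: eq_integral => x _; rewrite sumEFin; congr EFin.
  by rewrite !big_ord_recr big_ord0/= /c/=; ring.
rewrite integral_sum//.
have i4 (i : 'I_5) : (i <= 4)%N by rewrite -ltnS.
transitivity (\sum_(i < 5) (c i * moment i)%:E)%E.
  apply: eq_bigr => i _.
  by rewrite integralZl// ?momentE// integrable_pow_normal_pdf.
rewrite sumEFin; congr EFin.
by rewrite !big_ord_recr big_ord0/= /c/= moment0 M1 M2 M3 M4; ring.
Qed.
End normal_moments.

(** * Iterated integrals over independent coordinates *)

Section gint.
Variable R : realType.
Implicit Types (l : seq (R * R)) (f g : seq R -> \bar R).

Lemma gint_le l f g :
  (forall xs, size xs = size l -> f xs <= g xs)%E -> (gint l f <= gint l g)%E.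
Proof.
elim: l f g => [|p l IHl] f g fg /=; first exact: fg.
apply: le_integral_no_measurability => x.
by apply: IHl => xs sxs; apply: fg; rewrite /= sxs.
Qed.

Lemma eq_gint l f g :
  (forall xs, size xs = size l -> f xs = g xs) -> gint l f = gint l g.
Proof.
by move=> fg; apply/eqP; rewrite eq_le !gint_le// => xs /fg ->.
Qed.

Lemma gint_cst1 l : gint l (fun=> 1%E) = 1%E.
Proof.
elim: l => [//|p l IHl] /=; under eq_integral do rewrite IHl.
by rewrite integral_cst// mul1e; exact: (@probability_setT _ _ _ (normal_prob p.1 p.2)).
Qed.

(* For independent coordinates the second moment of [r + sum_i q_i] is
   [(r + sum_i M_i) ^+ 2] plus the sum of the variances; the terms [w] carry
   variances that have been integrated out at an earlier stage. *)
Lemma gint_sum_moments l (q w : nat -> R -> R) (M V : nat -> R) :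
  (forall i, (i < size l)%N -> forall k r u : R,
    (\int[normal_prob (nth (0, 0)%R l i).1 (nth (0, 0)%R l i).2]_x
      (1 - k * ((r + q i x) ^+ 2 + u + w i x))%:E
     = (1 - k * ((r + M i) ^+ 2 + u + V i))%:E)%E) ->
  forall k r u,
  gint l (fun xs => (1 - k * ((r + \sum_(i < size l) q i (nth 0 xs i)) ^+ 2
                       + u + \sum_(i < size l) w i (nth 0 xs i)))%:E)
  = (1 - k * ((r + \sum_(i < size l) M i) ^+ 2 + u + \sum_(i < size l) V i))%:E.
Proof.
elim: l q w M V => [|p l IHl] q w M V H k r u /=.
  by rewrite !big_ord0.
(* The remaining coordinates are integrated first, with the outer variable absorbed into the offsets
   [r + q 0 x] and [u + w 0 x]; the statement is therefore general in [r] and [u]. *)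
transitivity (\int[normal_prob p.1 p.2]_x
   (1 - k * (((r + \sum_(i < size l) M i.+1) + q 0 x) ^+ 2
     + (u + \sum_(i < size l) V i.+1) + w 0 x))%:E)%E.
  apply: eq_integral => x _.
  rewrite -[RHS]/(1 - _)%:E.
  have -> : 1 - k * ((r + \sum_(i < size l) M i.+1 + q 0 x) ^+ 2
         + (u + \sum_(i < size l) V i.+1) + w 0 x)
     = 1 - k * ((r + q 0 x + \sum_(i < size l) M i.+1) ^+ 2
         + (u + w 0 x) + \sum_(i < size l) V i.+1) by ring.
  rewrite -(IHl (fun i => q i.+1) (fun i => w i.+1) (fun i => M i.+1) (fun i => V i.+1)).
    apply: eq_gint => xs _; congr EFin.
    by rewrite !big_ord_recl /=; ring.
  by move=> i il; exact: (H i.+1).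
rewrite (H 0) //; congr EFin; rewrite !big_ord_recl /=; ring.
Qed.

(** A shifted normal square has mean [b ^+ 2 + s ^+ 2] and variance
    [4 * b ^+ 2 * s ^+ 2 + 2 * s ^+ 4]. The form is that of the one-coordinate hypothesis of
    [gint_sum_moments]. *)
Lemma moments_shifted_square (m s b e h : R) : s != 0 -> forall k r u,
  (\int[normal_prob m s]_x
     (1 - k * ((r + ((x - m + b) ^+ 2 + e)) ^+ 2 + u + h * (x - m + b) ^+ 2))%:E
   = (1 - k * ((r + (b ^+ 2 + s ^+ 2 + e)) ^+ 2 + u
        + (4 * b ^+ 2 * s ^+ 2 + 2 * s ^+ 4 + h * (b ^+ 2 + s ^+ 2))))%:E)%E.
Proof.
move=> s0 k r u; set A := r + b ^+ 2 + e.
transitivity (\int[normal_prob m s]_x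
  ((1 - k * (A ^+ 2 + u + h * b ^+ 2)) + (- k * (4 * A * b + 2 * h * b)) * (x - m)
   + (- k * (2 * A + 4 * b ^+ 2 + h)) * (x - m) ^+ 2
   + (- k * (4 * b)) * (x - m) ^+ 3 + (- k) * (x - m) ^+ 4)%:E)%E.
  by apply: eq_integral => x _; congr EFin; rewrite /A; ring.
by rewrite integral_normal_prob_quartic//; congr EFin; rewrite /A; ring.
Qed.

End gint.

(** * Splitting the squared norm into finitely many coordinates and the bias *)

Section sqnorm.
Variable R : realType.

Lemma sum_nat_tail_cvg (u : nat -> R) m : cvgn (series u) ->
  (\sum_(m <= j < n) u j) @[n --> \oo] --> limn (series u) - \sum_(j < m) u j.
Proof.
move=> cu.
have : (series u n - series u m) @[n --> \oo] --> limn (series u) - series u m.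
  by apply: cvgB => //; exact: cvg_cst.
have -> : \sum_(j < m) u j = series u m by rewrite /series/= big_mkord.
apply: cvg_trans; apply: near_eq_cvg; near=> n.
rewrite {1}/series/= (@big_cat_nat _ _ _ m)//=; first by rewrite /series/= addrAC subrr add0r.
by near: n; exact: nbhs_infty_ge.
Unshelve. all: end_near.
Qed.

Lemma biasE (theta eta : nat -> R) m :
  cvgn (series (fun j => (theta j - eta j) ^+ 2)) ->
  bias theta eta m = sqnorm (fun j => theta j - eta j)
    - \sum_(j < m) (theta j - eta j) ^+ 2.
Proof. by move=> cu; apply/cvg_lim => //; exact: sum_nat_tail_cvg. Qed.

Lemma sqnorm_extend (theta eta : nat -> R) (xs : seq R) :
  cvgn (series (fun j => (theta j - eta j) ^+ 2)) ->
  sqnorm (fun j => extend eta xs j - theta j)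
  = \sum_(j < size xs) (nth 0 xs j - theta j) ^+ 2 + bias theta eta (size xs).
Proof.
move=> cu; apply/cvg_lim => //.
have := sum_nat_tail_cvg _ (size xs) cu.
rewrite -biasE// => h.
apply: (@cvg_trans _ ((\sum_(j < size xs) (nth 0 xs j - theta j) ^+ 2 +
  \sum_(size xs <= j < n) (theta j - eta j) ^+ 2) @[n --> \oo])); last first.
  by apply: cvgD => //; exact: cvg_cst.
apply: near_eq_cvg; near=> n.
rewrite /series/= [RHS](@big_cat_nat _ _ _ (size xs))//=; last by near: n; exact: nbhs_infty_ge.
congr (_ + _).
  by rewrite [RHS]big_mkord; apply: eq_bigr => j _; rewrite /extend ltn_ord.
rewrite big_nat_cond [RHS]big_nat_cond; apply: eq_bigr => j /andP[/andP[j1 _] _].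
by rewrite /extend ltnNge j1/= -sqrrN opprB.
Unshelve. all: end_near.
Qed.

Lemma bias_ge0 (theta eta : nat -> R) m :
  cvgn (series (fun j => (theta j - eta j) ^+ 2)) -> 0 <= bias theta eta m.
Proof.
move=> cu; apply: limr_ge.
  by apply/cvg_ex; exists (bias theta eta m); rewrite biasE//; exact: sum_nat_tail_cvg.
by apply: nearW => n; apply: sumr_ge0 => j _; exact: sqr_ge0.
Qed.

Lemma bias_cvg0 (theta eta : nat -> R) :
  cvgn (series (fun j => (theta j - eta j) ^+ 2)) ->
  bias theta eta m @[m --> \oo] --> (0 : R).
Proof.
set u := fun j => _; move=> cu.
have -> : bias theta eta = (fun m => limn (series u) - series u m).
  by apply/funext => m; rewrite biasE// /series/= big_mkord.
rewrite -(subrr (limn (series u))).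
by apply: cvgB => //; exact: cvg_cst.
Qed.

End sqnorm.

(** * Joint moments of the data and the posterior draw *)

Section joint_law.
Variables (R : realType) (lam theta eta tau : nat -> R) (eps : R).
Hypothesis eps0 : 0 < eps.
Hypothesis lam0 : forall j, lam j != 0.
Hypothesis tau0 : forall j, 0 < tau j.
Local Notation sigma := (post_var lam tau eps).

(* Under the joint law of data and posterior draw, the [j]-th error is normal
   with mean [err_mean j] and variance [err_var j]. *)
Definition err_mean j := sigma j / tau j * (eta j - theta j).
Definition err_var j := (sigma j * lam j / Num.sqrt eps) ^+ 2 + sigma j.

Lemma post_var_gt0 j : 0 < sigma j.
Proof.
rewrite /post_var invr_gt0 addr_gt0 ?invr_gt0// divr_gt0//.
by rewrite exprn_even_gt0/=.
Qed.

(** The posterior mean is affine in the data, so its error is a deterministic shrinkage term plus a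
    multiple of the noise. *)
Lemma post_mean_data xi j :
  post_mean lam tau eta eps (data_of lam theta eps xi) j - theta j
  = err_mean j + sigma j * lam j / Num.sqrt eps * nth 0 xi j.
Proof.
rewrite /post_mean /data_of /err_mean.
have t0 := tau0 j; have se : 0 < Num.sqrt eps by rewrite sqrtr_gt0.
have E : eps = Num.sqrt eps ^+ 2 by rewrite sqr_sqrtr// ltW.
have D : lam j ^+ 2 * tau j + eps != 0.
  by rewrite gt_eqF// addr_gt0// mulr_gt0// exprn_even_gt0/=.
rewrite /post_var; move: D; set e := Num.sqrt eps in se E *; rewrite E => D.
by field; rewrite D !gt_eqF.
Qed.

Definition post_laws m (Y : nat -> R) :=
  [seq (post_mean lam tau eta eps Y j, Num.sqrt (sigma j)) | j <- iota 0 m].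

(** Law of total variance in two stages: the posterior integral leaves the squared conditional mean
    and the conditional variance, and the noise integral then treats both as polynomials in the
    noise. *)
Lemma Eth_posterior_moments m k r :
  Eth lam theta eps m (fun Y => gint (post_laws m Y)
     (fun xs => (1 - k * (r + \sum_(j < m) (nth 0 xs j - theta j) ^+ 2) ^+ 2)%:E))
  = (1 - k * ((r + \sum_(j < m) (err_mean j ^+ 2 + err_var j)) ^+ 2
       + \sum_(j < m) (4 * err_mean j ^+ 2 * err_var j + 2 * err_var j ^+ 2)))%:E.
Proof.
pose c j := sigma j * lam j / Num.sqrt eps.
have inner Y : gint (post_laws m Y)
     (fun xs => (1 - k * (r + \sum_(j < m) (nth 0 xs j - theta j) ^+ 2) ^+ 2)%:E)
   = (1 - k * ((r + \sum_(j < m) ((post_mean lam tau eta eps Y j - theta j) ^+ 2 + sigma j)) ^+ 2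
      + 0 + \sum_(j < m) (4 * (post_mean lam tau eta eps Y j - theta j) ^+ 2 * sigma j + 2 * sigma j ^+ 2)))%:E.
  have sz : size (post_laws m Y) = m by rewrite size_map size_iota.
  transitivity (gint (post_laws m Y) (fun xs =>
    (1 - k * ((r + \sum_(j < size (post_laws m Y)) (nth 0 xs j - theta j) ^+ 2) ^+ 2
       + 0 + \sum_(j < size (post_laws m Y)) 0))%:E)).
    apply: eq_gint => xs _; congr EFin.
    by rewrite sz [\sum_(j < m) 0]big1// !addr0.
  rewrite (gint_sum_moments R _ (fun j x => (x - theta j) ^+ 2) (fun _ _ => 0)
    (fun j => (post_mean lam tau eta eps Y j - theta j) ^+ 2 + sigma j)
    (fun j => 4 * (post_mean lam tau eta eps Y j - theta j) ^+ 2 * sigma j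
       + 2 * sigma j ^+ 2)); first by rewrite sz.
  rewrite sz => i im k' r' u.
  rewrite (nth_map 0) ?size_iota//= nth_iota// add0n.
  set t := post_mean _ _ _ _ _ _; have si := post_var_gt0 i.
  have := moments_shifted_square R t (Num.sqrt (sigma i)) (t - theta i) 0 0 _ k' r' u.
  rewrite gt_eqF ?sqrtr_gt0// => /(_ isT) h.
  transitivity (\int[normal_prob t (Num.sqrt (sigma i))]_x (1 -
      k' * ((r' + ((x - t + (t - theta i)) ^+ 2 + 0)) ^+ 2 + u +
            0 * (x - t + (t - theta i)) ^+ 2))%:E)%E.
    by apply: eq_integral => x _; congr EFin; ring.
  rewrite h; congr EFin.
  have -> : Num.sqrt (sigma i) ^+ 4 = (Num.sqrt (sigma i) ^+ 2) ^+ 2 by ring.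
  by rewrite sqr_sqrtr ?(ltW si)//; ring.
rewrite /Eth.
under eq_gint => xs _ do rewrite inner.
have sz : size (nseq m ((0 : R), (1 : R))) = m by rewrite size_nseq.
transitivity (gint (nseq m ((0 : R), (1 : R))) (fun xi =>
  (1 - k * ((r + \sum_(j < size (nseq m ((0 : R), (1 : R))))
      ((err_mean j + c j * nth 0 xi j) ^+ 2 + sigma j)) ^+ 2 + 0
   + \sum_(j < size (nseq m ((0 : R), (1 : R))))
      (4 * (err_mean j + c j * nth 0 xi j) ^+ 2 * sigma j + 2 * sigma j ^+ 2)))%:E)).
  apply: eq_gint => xi _; rewrite sz; congr EFin.
  by do ![congr (_ + _)|congr (_ * _)|congr (- _)|congr (_ ^+ 2)];
    apply: eq_bigr => j _; rewrite post_mean_data.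
(* In the noise stage [w] is the conditional variance left by the posterior stage. *)
rewrite (gint_sum_moments R _
   (fun j x => (err_mean j + c j * x) ^+ 2 + sigma j)
   (fun j x => 4 * (err_mean j + c j * x) ^+ 2 * sigma j + 2 * sigma j ^+ 2)
   (fun j => err_mean j ^+ 2 + err_var j)
   (fun j => 4 * err_mean j ^+ 2 * err_var j + 2 * err_var j ^+ 2)).
  by rewrite sz addr0.
move=> i; rewrite sz => im k' r' u; rewrite nth_nseq im/=.
rewrite /err_var -/(c i); set a := err_mean i; set v := sigma i.
transitivity (\int[normal_prob 0 1]_x
  ((1 - k' * ((r' + a ^+ 2 + v) ^+ 2 + u + 4 * a ^+ 2 * v + 2 * v ^+ 2))
   + (- k' * (4 * (r' + a ^+ 2 + v) * a * c i + 8 * a * c i * v)) * (x - 0)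
   + (- k' * (2 * (r' + a ^+ 2 + v) * c i ^+ 2 + 4 * a ^+ 2 * c i ^+ 2 + 4 * c i ^+ 2 * v)) * (x - 0) ^+ 2
   + (- k' * (4 * a * c i ^+ 3)) * (x - 0) ^+ 3 + (- k' * c i ^+ 4) * (x - 0) ^+ 4)%:E)%E.
  by apply: eq_integral => x _; congr EFin; ring.
by rewrite integral_normal_prob_quartic//; congr EFin; ring.
Qed.

End joint_law.

(** * Chebyshev bound at a fixed noise level *)

Section fixed_noise.
Variables (R : realType) (lam theta eta tau : nat -> R) (eps d : R).
Hypothesis eps0 : 0 < eps.
Hypothesis lam0 : forall j, lam j != 0.
Hypothesis tau0 : forall j, 0 < tau j.
Hypothesis d0 : 0 < d.
Local Notation sigma := (post_var lam tau eps).
Local Notation emean := (err_mean R lam theta eta tau eps).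
Local Notation evar := (err_var R lam tau eps).

Lemma Lam_gt0 j : 0 < Lam lam j.
Proof. by rewrite /Lam invr_gt0 exprn_even_gt0/=. Qed.

Lemma Lam_le_LamMax m j : (j < m)%N -> Lam lam j <= LamMax lam m.
Proof. by move=> jm; rewrite /LamMax -[j]/(nat_of_ord (Ordinal jm)); exact: le_bigmax. Qed.

(** With [x = eps * Lam lam j] one has [sigma j = x * tau j / (x + tau j)] and
    [evar j = sigma j ^+ 2 / x + sigma j]. The two branches of the maximum serve different bounds:
    [d * x <= tau j] gives the lower bound on the variance, [d ^+ 2 * x <= tau j ^+ 2] the bound on
    the mean. *)
Lemma err_bounds j :
  d * Num.max (Num.sqrt (eps * Lam lam j)) (eps * Lam lam j) <= tau j ->
  [/\ eps * Lam lam j / (1 + d^-1) <= evar j,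
      evar j <= 2 * (eps * Lam lam j) &
      emean j ^+ 2 <= d^-2 * (eps * Lam lam j) * (theta j - eta j) ^+ 2].
Proof.
have [x xE] : {x | x = eps * Lam lam j} by exists (eps * Lam lam j).
rewrite -xE => htau.
have x0 : 0 < x by rewrite xE mulr_gt0// Lam_gt0.
have t0 := tau0 j; have l0 := lam0 j.
have xt0 : 0 < x + tau j by rewrite addr_gt0.
have dx : d * x <= tau j.
  by apply: le_trans htau; rewrite ler_pM2l// le_max lexx orbT.
have d2x : d ^+ 2 * x <= tau j ^+ 2.
  have -> : d ^+ 2 * x = (d * Num.sqrt x) ^+ 2 by rewrite exprMn sqr_sqrtr// ltW.
  rewrite lerXn2r ?nnegrE ?mulr_ge0 ?sqrtr_ge0 ?(ltW d0) ?(ltW t0)//.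
  by apply: le_trans htau; rewrite ler_pM2l// le_max lexx.
have sE : sigma j = x * tau j / (x + tau j).
  rewrite /post_var.
  have -> : lam j ^+ 2 / eps = x^-1 by rewrite xE /Lam invfM invrK mulrC.
  by field; rewrite !gt_eqF.
have s0 : 0 < sigma j by exact: post_var_gt0.
have vE : evar j = sigma j ^+ 2 / x + sigma j.
  rewrite /err_var; congr (_ + _).
  rewrite expr_div_n exprMn sqr_sqrtr ?ltW// xE /Lam.
  by field; rewrite l0 gt_eqF.
have sx : sigma j <= x.
  by rewrite sE ler_pdivrMr// ler_pM2l// lerDr ltW.
split.
- rewrite vE; apply: (@le_trans _ _ (sigma j)); last first.
    by rewrite lerDr divr_ge0 ?sqr_ge0// ltW.
  have -> : x / (1 + d^-1) = x * d / (d + 1).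
    by field; rewrite !gt_eqF// addr_gt0.
  rewrite sE ler_pdivrMr ?addr_gt0// [leRHS]mulrAC ler_pdivlMr//.
  by rewrite -!mulrA ler_pM2l//; lra.
- rewrite vE mulr2n mulrDl mul1r lerD// ler_pdivrMr// expr2 ler_pM// ltW//.
- rewrite /err_mean exprMn -[X in _ * X <= _]sqrrN opprB ler_wpM2r ?sqr_ge0//.
  have -> : sigma j / tau j = x / (x + tau j).
    by rewrite sE; field; rewrite !gt_eqF.
  rewrite expr_div_n ler_pdivrMr ?exprn_gt0//.
  rewrite -exprVn.
  have -> : d^-1 ^+ 2 * x * (x + tau j) ^+ 2 = x * (x + tau j) ^+ 2 / d ^+ 2.
    by field; rewrite gt_eqF.
  rewrite ler_pdivlMr ?exprn_gt0// expr2 -mulrA ler_pM2l//.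
  rewrite mulrC; apply: (le_trans d2x).
  by rewrite lerXn2r ?nnegrE ?ltW// ltrDr.
Qed.

Lemma LamBarE m : (1 <= m)%N -> m%:R * LamBar lam m = \sum_(j < m) Lam lam j.
Proof. by move=> m1; rewrite /LamBar mulrC divfK// pnatr_eq0 -lt0n. Qed.

Lemma Phi_gt0 m : (1 <= m)%N -> 0 < Phi theta eta lam eps m.
Proof.
move=> m1; rewrite /Phi lt_max -mulrA; apply/orP; right; rewrite mulr_gt0//.
rewrite LamBarE//; case: m m1 => // m _; rewrite big_ord_recl ltr_pwDl ?Lam_gt0//.
by apply: sumr_ge0 => j _; exact/ltW/Lam_gt0.
Qed.

Variables (m : nat) (Lo : R).
Hypothesis m1 : (1 <= m)%N.
Hypothesis Lo1 : 1 <= Lo.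
Hypothesis cu : cvgn (series (fun j => (theta j - eta j) ^+ 2)).
Hypothesis tau_ge : forall j, (j < m)%N ->
  d * Num.max (Num.sqrt (eps * Lam lam j)) (eps * Lam lam j) <= tau j.
Local Notation Ph := (Phi theta eta lam eps m).
Hypothesis LamMax_le : eps * m%:R * LamMax lam m <= Lo * Ph.
Local Notation D := (d^-2 * sqnorm (fun j => theta j - eta j)).

Let T := eps * \sum_(j < m) Lam lam j.
Let A := \sum_(j < m) emean j ^+ 2.
Let B := \sum_(j < m) evar j.
Let W := \sum_(j < m) (4 * emean j ^+ 2 * evar j + 2 * evar j ^+ 2).
Let h := 1 + d^-1.

Let h1 : 1 <= h. Proof. by rewrite lerDl invr_ge0 ltW. Qed.

Let PhE : Ph = Num.max (bias theta eta m) T.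
Proof. by rewrite /Phi -mulrA LamBarE. Qed.

Let b_le : 0 <= bias theta eta m <= Ph.
Proof. by rewrite bias_ge0//= PhE le_max lexx. Qed.

Let T_le : 0 <= T <= Ph.
Proof.
rewrite PhE le_max lexx orbT andbT /T mulr_ge0 ?(ltW eps0)// sumr_ge0// => j _.
exact/ltW/Lam_gt0.
Qed.

Let Ph0 : 0 < Ph. Proof. exact: Phi_gt0. Qed.

Let sqnorm_ge : \sum_(j < m) (theta j - eta j) ^+ 2 <= sqnorm (fun j => theta j - eta j).
Proof. by have := bias_ge0 _ _ _ m cu; rewrite biasE// subr_ge0. Qed.

Let LM_le j : (j < m)%N -> eps * Lam lam j <= Lo * Ph / m%:R.
Proof.
move=> jm; rewrite ler_pdivlMr ?ltr0n//; apply: le_trans LamMax_le.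
by rewrite -!mulrA ler_pM2l// mulrC ler_pM2l ?ltr0n// Lam_le_LamMax.
Qed.

Let A_le : 0 <= A <= D * (Lo * Ph / m%:R).
Proof.
rewrite {1}/A sumr_ge0/=; last by move=> j _; exact: sqr_ge0.
apply: (@le_trans _ _ (\sum_(j < m) d^-2 * (Lo * Ph / m%:R) * (theta j - eta j) ^+ 2)).
  apply: ler_sum => j _; have [_ _ /le_trans] := err_bounds j (tau_ge j (ltn_ord j)).
  apply; rewrite ler_wpM2r ?sqr_ge0// ler_pM2l ?LM_le//.
  by rewrite invr_gt0 exprn_gt0.
rewrite -mulr_sumr -!mulrA ler_pM2l ?invr_gt0 ?exprn_gt0// [leRHS]mulrC -!mulrA.
have LoP : 0 < Lo * Ph / m%:R by rewrite divr_gt0 ?ltr0n// mulr_gt0// (lt_le_trans _ Lo1).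
by rewrite !mulrA ler_pM2l.
Qed.

Let B_bounds : T / h <= B <= 2 * T.
Proof.
rewrite /T /B -mulrA mulrC -mulrA [X in X <= _](_ : _ = \sum_(j < m) eps * Lam lam j / h); last first.
  by rewrite -mulr_suml -mulr_sumr; ring.
apply/andP; split.
  by apply: ler_sum => j _; have [] := err_bounds j (tau_ge j (ltn_ord j)).
rewrite !mulr_sumr.
by apply: ler_sum => j _; have [] := err_bounds j (tau_ge j (ltn_ord j)).
Qed.

(** Write [x] for [eps * Lam lam j] and [LM] for [Lo * Ph / m%:R]. From [v <= 2 * x] and [x <= LM]
    follow [4 * a * v <= 8 * a * LM] and [2 * v ^+ 2 <= 8 * LM * x]. *)
Let W_le : W <= 8 * (Lo * Ph / m%:R) * (A + T).
Proof.
rewrite /A /T mulr_sumr -big_split/= mulr_sumr; apply: ler_sum => j _.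
have [lb ub _] := err_bounds j (tau_ge j (ltn_ord j)).
have := LM_le j (ltn_ord j); have := sqr_ge0 (emean j).
have : 0 <= eps * Lam lam j / (1 + d^-1).
  by rewrite divr_ge0 ?mulr_ge0 ?(ltW eps0) ?(ltW (Lam_gt0 j))// (le_trans _ h1).
have : 0 < eps * Lam lam j by rewrite mulr_gt0// Lam_gt0.
move: lb ub; move: (eps * Lam lam j) (emean j ^+ 2) (evar j) (Lo * Ph / m%:R).
move=> x a v LM lb ub x0 x1 a0 xLM.
have v0 : 0 <= v by exact: le_trans x1 lb.
have : a * v <= a * (2 * LM) by rewrite ler_wpM2l//; lra.
have : v ^+ 2 <= 2 * LM * (2 * x).
  by rewrite expr2; apply: ler_pM => //; lra.
lra.
Qed.

Local Notation K := (10 * Num.max h D * Lo).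
(** Half of the lower bound [Ph / h] on the mean. *)
Let delta := Ph / (2 * h).
Let mean := bias theta eta m + A + B.

(** From below, [bias + T / h] dominates [max bias T / h] because [1 <= h]. From above, the bias and
    [A] count once each and [B] twice, which gives the factor 4. *)
Let mean_bounds : Ph / h <= mean <= 4 * Num.max h D * Lo * Ph.
Proof.
have /andP[b0 b1] := b_le; have /andP[t0 t1] := T_le.
have /andP[a0 a1] := A_le; have /andP[B0 B1] := B_bounds.
have h0 : 0 < h by exact: lt_le_trans h1.
apply/andP; split.
  rewrite /mean; apply: (@le_trans _ _ (bias theta eta m + T / h)); last lra.
  have bh : bias theta eta m <= bias theta eta m * h by rewrite ler_peMr.
  rewrite PhE ler_pdivrMr// mulrDl divfK ?gt_eqF// ge_max; apply/andP; split; lra.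
have mR : 1 <= m%:R :> R by rewrite ler1n.
have D0 : 0 <= D.
  rewrite mulr_ge0 ?invr_ge0 ?exprn_ge0 ?(ltW d0)//.
  by apply: le_trans sqnorm_ge; apply: sumr_ge0 => j _; exact: sqr_ge0.
have LoP : 0 < Lo * Ph by rewrite mulr_gt0// (lt_le_trans _ Lo1).
have a2 : A <= Num.max h D * (Lo * Ph).
  apply: (le_trans a1); apply: ler_pM => //.
  - by rewrite divr_ge0// ltW.
  - by rewrite le_max lexx orbT.
  - by rewrite ler_pdivrMr ?ltr0n// ler_peMr// ltW.
have p2 : Ph <= Num.max h D * (Lo * Ph).
  rewrite mulrA ler_peMl ?(ltW Ph0)// -[1]mulr1; apply: ler_pM => //.
  by rewrite le_max h1.
rewrite /mean; lra.
Qed.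

(** Within [delta] of the mean, [S] is at least [Ph / (2 * h)] and at most 4.5 times
    [Num.max h D * Lo * Ph]; the factor 10 in [K] covers both. *)
Let small_ball (S : R) : `|S - mean| <= delta ->
  K^-1 * Ph <= S <= K * Ph.
Proof.
have /andP[l1 l2] := mean_bounds.
have h0 : 0 < h by exact: lt_le_trans h1.
have M1 : h <= Num.max h D by rewrite le_max lexx.
have MLo : h <= Num.max h D * Lo.
  by rewrite (le_trans M1)// ler_peMr// (le_trans _ M1)// ltW.
have dE : delta = Ph / h / 2 by rewrite /delta; field; rewrite gt_eqF.
have dP : Ph / h <= Ph by rewrite ler_pdivrMr// ler_peMr// ltW.
have PP : Ph <= Num.max h D * Lo * Ph by rewrite ler_peMl ?(ltW Ph0)// (le_trans h1).
have kP : K^-1 * Ph <= Ph / h / 10.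
  have -> : Ph / h / 10 = (10 * h)^-1 * Ph by field; rewrite gt_eqF.
  have ML0 : 0 < Num.max h D * Lo by exact: lt_le_trans MLo.
  by rewrite ler_pM2r// -[10 * _ * Lo]mulrA lef_pV2 ?posrE ?(mulr_gt0 _ ML0) ?(mulr_gt0 _ h0)// ler_pM2l.
have hP : 0 < Ph / h by rewrite divr_gt0.
rewrite ler_norml dE => /andP[s1 s2]; apply/andP; split; first lra.
rewrite -!mulrA in l2 PP *; lra.
Qed.

(** The factor 32 is 8 from [W_le] times 4 from [(delta ^+ 2)^-1 = 4 * h ^+ 2 / Ph ^+ 2]. *)
Lemma Eth_posterior_bounds :
  let C := 32 * h ^+ 2 * Lo * (D * Lo + 1) in
  ((1 - C / m%:R)%:E <=
   Eth lam theta eps m (fun Y => post_prob lam tau eta eps m Y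
     [set v | (K^-1 * Ph <= sqnorm (fun j => v j - theta j) <= K * Ph)%R]%classic) <= 1)%E.
Proof.
simpl; set C := (X in (1 - X / _)%:E); apply/andP; split; last first.
  rewrite -(gint_cst1 R (nseq m (0, 1))); apply: gint_le => xi _.
  rewrite -[leRHS](gint_cst1 R (post_laws R lam eta tau eps m (data_of lam theta eps xi))).
  apply: gint_le => xs _; rewrite lee_fin indicE.
  by case: (_ \in _).
have h0 : 0 < h by exact: lt_le_trans h1.
pose k := (delta ^+ 2)^-1.
have delta0 : 0 < delta by rewrite divr_gt0// mulr_gt0.
have k0 : 0 < k by rewrite invr_gt0 exprn_gt0.
(* The offset [r = bias - mean] centres the loss, so the squared expectation vanishes and only the
   variance [W] remains. *)
apply: (@le_trans _ _ (1 - k * ((bias theta eta m - mean + (A + B)) ^+ 2 + W))%:E).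
  rewrite lee_fin lerD2l lerN2.
  have -> : bias theta eta m - mean + (A + B) = 0 by rewrite /mean; ring.
  rewrite expr0n/= add0r.
  apply: (@le_trans _ _ (k * (8 * (Lo * Ph / m%:R) * ((D * Lo + 1) * Ph)))).
    rewrite ler_pM2l//; apply: (le_trans W_le); rewrite ler_pM2l; last first.
      by rewrite mulr_gt0// divr_gt0 ?ltr0n// mulr_gt0// (lt_le_trans _ Lo1).
    have /andP[_ t1] := T_le; have /andP[_ a1] := A_le.
    rewrite mulrDl mul1r lerD// (le_trans a1)// -[leRHS]mulrA.
    have D0 : 0 <= D.
      rewrite mulr_ge0 ?invr_ge0 ?exprn_ge0 ?(ltW d0)//.
      by apply: le_trans sqnorm_ge; apply: sumr_ge0 => j _; exact: sqr_ge0.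
    rewrite ler_wpM2l// ler_pdivrMr ?ltr0n// ler_peMr ?ler1n//.
    by rewrite mulr_ge0// ?(ltW Ph0)// (le_trans _ Lo1).
  rewrite le_eqVlt; apply/orP; left; apply/eqP.
  rewrite /k /delta /C; field.
  by rewrite !gt_eqF ?ltr0n.
rewrite /A /B -big_split/= -(Eth_posterior_moments R lam theta eta tau eps)//.
apply: gint_le => xi _; apply: gint_le => xs.
rewrite size_map size_iota => sxs; rewrite lee_fin indicE.
set S := \sum_(j < m) _.
have -> : bias theta eta m - mean + S = S + bias theta eta m - mean by ring.
have SE : sqnorm (fun j => extend eta xs j - theta j) = S + bias theta eta m.
  by rewrite sqnorm_extend// sxs.
(* Pointwise Chebyshev: near the mean the indicator is 1 and the polynomial at most 1; far from it
   the polynomial is at most 0. *)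
have [near|far] := leP `|S + bias theta eta m - mean| delta.
  rewrite mem_set/=; last by rewrite SE; exact: small_ball.
  by rewrite lerBlDr lerDl mulr_ge0 ?sqr_ge0// ltW.
apply: (@le_trans _ _ 0); last by case: (_ \in _).
rewrite subr_le0 /k mulrC ler_pdivlMr ?exprn_gt0// mul1r.
by rewrite -[leRHS]real_normK ?num_real// lerXn2r ?nnegrE ?(ltW far) ?(ltW delta0).
Qed.

End fixed_noise.

(* [LamMax m] dominates [Lam 0] and [eps * m * LamMax m <= Lo * Phi], so a small
   oracle risk forces both defining constraints of [Geps]. *)
Lemma le_Geps (R : realType) (lam theta eta : nat -> R) (eps Lo : R) m :
  0 < eps -> (forall j, lam j != 0) -> (1 <= m)%N ->
  eps * m%:R * LamMax lam m <= Lo * Phi theta eta lam eps m ->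
  Lo * Phi theta eta lam eps m <= Lam lam 0 -> (m <= Geps lam eps)%N.
Proof.
move=> eps0 lam0 m1 h1 h2.
have L0 := Lam_gt0 R lam lam0 0.
have h3 := le_trans h1 h2.
have LM : Lam lam 0 <= LamMax lam m by exact: Lam_le_LamMax.
have LM0 : 0 < LamMax lam m by exact: lt_le_trans LM.
have mR : 1 <= m%:R :> R by rewrite ler1n.
have em : eps * m%:R <= 1.
  rewrite -(ler_pM2r L0) mul1r; apply: le_trans h3.
  by rewrite ler_pM2l// mulr_gt0// ltr0n.
have mt : (m < (Num.truncn eps^-1).+1)%N.
  rewrite ltnS truncn_ge_nat ?invr_ge0 ?(ltW eps0)//.
  by rewrite -(ler_pM2l eps0) divff ?gt_eqF.
rewrite /Geps -[m in (m <= _)%N]/(nat_of_ord (Ordinal mt)).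
apply: leq_bigmax_cond; rewrite /= m1/=.
apply: le_trans h3; rewrite -mulrA ler_pM2l// ler_peMl// ltW//.
Qed.

(** * Passage to the limit of vanishing noise *)

Theorem mainTheorem7 (R : realType) (lam theta eta : nat -> R)
  (tau : R -> nat -> R) (d Lo : R) (mo : R -> nat) :
  (exists C : R, forall j, `|lam j| <= C) ->
  (forall j, lam j != 0) ->
  cvgn (series (fun j => theta j ^+ 2)) ->
  cvgn (series (fun j => (theta j - eta j) ^+ 2)) ->
  (forall eps, 0 < eps < 1 -> forall j, 0 < tau eps j) ->
  (forall eps, 0 < eps < 1 -> is_oracle_dim theta eta lam eps (mo eps)) ->
  AssumptionA lam tau d ->
  1 <= Lo ->
  (forall eps, 0 < eps < 1 ->
     eps * (mo eps)%:R * LamMax lam (mo eps) / Phi theta eta lam eps (mo eps) <= Lo) ->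
  (forall M : nat, exists2 delta : R, 0 < delta &
     forall eps, 0 < eps < delta -> (M <= mo eps)%N) ->
  let Ko := 10 * Num.max (1 + d^-1) (d^-2 * sqnorm (fun j => theta j - eta j)) * Lo in
  (Eth lam theta eps (mo eps)
     (fun Y => post_prob lam (tau eps) eta eps (mo eps) Y
        [set v | Ko^-1 * Phi theta eta lam eps (mo eps) <= sqnorm (fun j => v j - theta j)
                 <= Ko * Phi theta eta lam eps (mo eps)]))
   @[eps --> 0^'+] --> 1%E.
Proof.
move=> _ lam0 _ cu tau0 oracle [d0 A] Lo1 LamMax_le mo_oo Ko.
have Lo0 : 0 < Lo by exact: lt_le_trans Lo1.
pose N := sqnorm (fun j => theta j - eta j).
pose C := 32 * (1 + d^-1) ^+ 2 * Lo * (d^-2 * N * Lo + 1).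
have L0 := Lam_gt0 R lam lam0 0.
have e0 : 0 < Lam lam 0 / Lo by rewrite divr_gt0.
(* A fixed competitor [k] with small bias. Once [eps] is small its variance term is small too, and
   minimality at [mo eps] yields the bound on the oracle risk that [le_Geps] requires. *)
have [k k1 bk] : exists2 k, (1 <= k)%N & bias theta eta k <= Lam lam 0 / Lo.
  have b0 := bias_cvg0 R theta eta cu.
  have : \forall k \near \oo, (1 <= k)%N /\ bias theta eta k <= Lam lam 0 / Lo.
    near=> k; split; first by near: k; exact: nbhs_infty_ge.
    near: k; have /cvgrPdist_le/(_ _ e0) := b0; apply: filterS => k.
    by rewrite sub0r normrN; apply: le_trans; exact: ler_norm.
  by move=> [k _ /(_ k (leqnn k))[? ?]]; exists k.
have S0 : 0 < \sum_(j < k) Lam lam j.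
  case: k k1 {bk} => // k _; rewrite big_ord_recl ltr_pwDl ?Lam_gt0//.
  by apply: sumr_ge0 => j _; exact/ltW/Lam_gt0.
have near_bounds : \forall eps \near 0^'+,
  ((1 - C / (mo eps)%:R)%:E <= Eth lam theta eps (mo eps)
     (fun Y => post_prob lam (tau eps) eta eps (mo eps) Y
        [set v | (Ko^-1 * Phi theta eta lam eps (mo eps) <= sqnorm (fun j => v j - theta j)
                 <= Ko * Phi theta eta lam eps (mo eps))%R]%classic) <= 1)%E.
  near=> eps.
  have eps0 : 0 < eps by near: eps; exact: nbhs_right_gt.
  have eps1 : eps < 1 by near: eps; exact: nbhs_right_lt.
  have epsk : eps <= Lam lam 0 / Lo / \sum_(j < k) Lam lam j.
    by near: eps; apply: nbhs_right_ltW; rewrite divr_gt0.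
  have eps01 : 0 < eps < 1 by rewrite eps0.
  have [m1 mmin _] := oracle eps eps01.
  have Ph0 := Phi_gt0 R lam theta eta eps eps0 lam0 _ m1.
  have LM : eps * (mo eps)%:R * LamMax lam (mo eps) <= Lo * Phi theta eta lam eps (mo eps).
    by rewrite -ler_pdivrMr//; exact: LamMax_le.
  have PhL : Lo * Phi theta eta lam eps (mo eps) <= Lam lam 0.
    rewrite mulrC -ler_pdivlMr//; apply: (le_trans (mmin _ k1)).
    by rewrite /Phi ge_max bk/= -mulrA LamBarE// -ler_pdivlMr.
  have mG := le_Geps R lam theta eta eps Lo _ eps0 lam0 m1 LM PhL.
  apply: Eth_posterior_bounds => //; first exact: tau0.
  by move=> j jm; apply: A => //; exact: leq_trans mG.
apply: (squeeze_cvge near_bounds); last exact: cvg_cst.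
apply: cvg_EFin; first exact: nearW.
apply/cvgrPdist_le => e epos.
have C0 : 0 <= C.
  have N0 : 0 <= N by apply: le_trans (bias_ge0 R theta eta 0 cu) _; rewrite biasE// big_ord0 subr0.
  have d20 : 0 <= d^-2 by rewrite invr_ge0 exprn_ge0// ltW.
  have dN : 0 <= d^-2 * N * Lo by rewrite !mulr_ge0// ltW.
  apply: mulr_ge0; last exact: addr_ge0.
  by apply: mulr_ge0; [apply: mulr_ge0; [|exact: sqr_ge0]|exact: ltW].
(* Dimensions above [C / e] make the defect [C / (mo eps)%:R] at most [e]. *)
have [delta delta0 hM] := mo_oo (Num.truncn (C / e)).+1.
near=> eps.
have eps0 : 0 < eps by near: eps; exact: nbhs_right_gt.
have epsd : eps < delta by near: eps; exact: nbhs_right_lt.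
have : ((Num.truncn (C / e)).+1 <= mo eps)%N by apply: hM; rewrite eps0.
rewrite -(ler_nat R) => hm.
have Ce : C / e < (mo eps)%:R by apply: lt_le_trans hm; exact: truncnS_gt.
have m0 : 0 < (mo eps)%:R :> R by apply: le_lt_trans Ce; rewrite divr_ge0// ltW.
rewrite opprB addrC subrK ger0_norm ?divr_ge0 ?(ltW m0)//.
by rewrite ler_pdivrMr// mulrC -ler_pdivrMr// ltW.
Unshelve. all: end_near.
Qed.
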